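(* Let $(W,S)$ be a finite Coxeter group and $p$ a prime. Let $D=(d_{KL})_{K\in E,\,L\in F}$ be the matrix with $d_{KL}=1$ if columns $K$ and $L$ of the parabolic table of marks $M^c(W)$ are equal modulo $p$, and $d_{KL}=0$ otherwise. Then $D$ is the decomposition matrix (modulo $p$) of the descent algebra $\Sigma_W$; that is, for $K\in E$ and $L\in F$, $d_{KL}$ is the multiplicity of the irreducible representation of $\Sigma(W,p)$ indexed by $L$ as a composition factor of the reduction modulo $p$ of the irreducible representation $\lambda_K$ of $\Sigma_W$ indexed by $K$.
   Context: For $L\subseteq S$, $W_L=\langle L\rangle$, $X_L$ is the set of minimal length representatives of the left cosets $wW_L$ of $W_L$ in $W$, and $x_L=\sum_{w\in X_L}w\in\mathbb{Q}W$. By Solomon's theorem the $x_L$ ($L\subseteq S$) form a basis of a subalgebra $\Sigma_W$ of $\mathbb{Q}W$ (the descent algebra) with integer structure constants; $\mathcal{Z}_W$ is the $\mathbb{Z}$-span of the $x_L$, $\Sigma(W,p)=\mathcal{Z}_W/p\mathcal{Z}_W$, and $\overline{x}_L$ is the image of $x_L$. $E$ is a set of representatives of the $W$-conjugacy classes of subsets of $S$; $\beta_{JK}$ is the number of fixed points of $W_K$ on $W/W_J$; $M^c(W)=(\beta_{JK})_{J,K\in E}$. $F\subseteq E$ is the set of $J\in E$ whose row of $M^c(W)$ is non-zero modulo $p$ (equivalently, $p\nmid[N_W(W_J):W_J]$). The irreducible representations of $\Sigma_W$ are indexed by $E$: $\lambda_K:\Sigma_W\to\mathbb{Q}$, $\lambda_K(x_J)=\beta_{JK}$.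 These take integer values on $\mathcal{Z}_W$, and the reduction modulo $p$ of $\lambda_K$ is the representation $\overline{x}_J\mapsto\beta_{JK}\bmod p$ of $\Sigma(W,p)$ over $\mathbb{F}_p$. The irreducible representations of $\Sigma(W,p)$ are indexed by $F$: $L\in F$ corresponds to $\overline{x}_J\mapsto\beta_{JL}\bmod p$. *)

(* Defs.v *)
From HB Require Import structures.
From mathcomp Require Import all_boot all_order all_algebra all_fingroup.
From mathcomp Require Import boolp.

Set Implicit Arguments.
Unset Strict Implicit.
Unset Printing Implicit Defensive.

Import GRing.Theory.
Local Open Scope ring_scope.

(* (W, S) is a Coxeter system: S generates W, consists of elements of order 2,
   and W is presented by the relations (s t)^m(s,t) = 1, where m(s,t) is the
   order of s t; the presentation is expressed by its universal property among
   all (possibly infinite) groups. *)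
Definition coxeter_system (W : finGroupType) (S : {set W}) : Prop :=
  [/\ <<S>>%g = [set: W],
      {in S, forall s, #[s]%g = 2}
    & forall (G : groupType) (f : W -> G),
        {in S &, forall s t, ((f s * f t) ^+ #[(s * t)%g] = 1)%g} ->
        exists2 g : W -> G, {morph g : x y / (x * y)%g} & {in S, g =1 f}].

(* The group algebra Q[W] with the convolution product. The alias avoids the
   pointwise product carried by {ffun W -> rat}; the values are taken in rat^o
   to obtain the structure of vector space over rat. *)
Definition group_alg (W : finGroupType) : Type := {ffun W -> rat^o}.

Section GroupAlgebra.
Variable W : finGroupType.

HB.instance Definition _ := Vector.copy (group_alg W) {ffun W -> rat^o}.

Implicit Types a b c : group_alg W.

Definition galg_one : group_alg W := [ffun w => (w == 1%g)%:R].

Definition galg_mul a b : group_alg W :=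
  [ffun w => \sum_(u : W) (a u : rat) * b (u^-1 * w)%g].

Fact galg_mulA : associative galg_mul.
Proof.
move=> a b c; apply/ffunP=> w; rewrite !ffunE.
under eq_bigr => u _ do rewrite ffunE big_distrr /=.
under [RHS]eq_bigr => v _ do rewrite ffunE big_distrl /=.
rewrite [RHS]exchange_big /=; apply: eq_bigr => u _.
rewrite [RHS](reindex_inj (mulgI u)) /=; apply: eq_bigr => v _.
by rewrite mulKg invMg !mulgA mulrA.
Qed.

Fact galg_mul1 : left_id galg_one galg_mul.
Proof.
move=> a; apply/ffunP=> w; rewrite !ffunE (bigD1 1%g) //= big1 => [|u /negPf u1].
  by rewrite ffunE eqxx mul1r invg1 mul1g addr0.
by rewrite ffunE u1 mul0r.
Qed.

Fact galg_mulr1 : right_id galg_one galg_mul.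
Proof.
move=> a; apply/ffunP=> w; rewrite !ffunE (bigD1 w) //= big1 => [|u uw].
  by rewrite ffunE mulVg eqxx mulr1 addr0.
by rewrite ffunE -eq_mulVg1 (negPf uw) mulr0.
Qed.

Fact galg_mulDl : left_distributive galg_mul +%R.
Proof.
move=> a b c; apply/ffunP=> w; rewrite !ffunE -big_split /=.
by apply: eq_bigr => u _; rewrite ffunE mulrDl.
Qed.

Fact galg_mulDr : right_distributive galg_mul +%R.
Proof.
move=> a b c; apply/ffunP=> w; rewrite !ffunE -big_split /=.
by apply: eq_bigr => u _; rewrite ffunE mulrDr.
Qed.

Fact galg_one_neq0 : galg_one != 0.
Proof. by apply/eqP=> /ffunP/(_ 1%g)/eqP; rewrite !ffunE eqxx. Qed.

HB.instance Definition _ := GRing.Zmodule_isNzRing.Build (group_alg W)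
  galg_mulA galg_mul1 galg_mulr1 galg_mulDl galg_mulDr galg_one_neq0.

End GroupAlgebra.

Section DescentAlgebra.
Variables (W : finGroupType) (S : {set W}).
Implicit Types (J K L : {set W}) (w : W).

Fact length_subproof w :
  exists n, (w \in <<S>>%g) ==> (w \in (S ^+ n)%g).
Proof.
case: (boolP (w \in <<S>>%g)) => [/gen_prodgP[n [c cS ->]]|_]; last by exists 0%N.
exists n => /=; elim: n c cS => [|n IHn] c cS; first by rewrite big_ord0 set11.
by rewrite big_ord_recl expgS mem_mulg ?IHn.
Qed.

(* S ^+ n is the set of products of n elements of S. *)
Definition cox_length w : nat := ex_minn (length_subproof w).

Definition min_reps L : {set W} :=
  [set w | [forall u in (w *: <<L>>)%g, (cox_length w <= cox_length u)%N]].

Definition xbasis L : group_alg W := [ffun w => (w \in min_reps L)%:R].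

Definition xtuple : #|powerset S|.-tuple (group_alg W) :=
  image_tuple xbasis (powerset S).

Definition descent_alg : {vspace group_alg W} := <<xtuple>>%VS.

Definition in_descent_alg (z : group_alg W) : Prop := z \in descent_alg.

Definition in_ZW (z : group_alg W) : Prop :=
  exists c : {set W} -> int, z = \sum_(L in powerset S) xbasis L *~ c L.

Definition in_pZW (p : nat) (z : group_alg W) : Prop :=
  exists2 y, in_ZW y & z = y *+ p.

Definition class_reps (E : {set {set W}}) : bool :=
  is_transversal E
    (equivalence_partition (fun J K => K \in (J :^: [set: W])%g) (powerset S))
    (powerset S).

Definition mark J K : nat :=
  #|[set C in lcosets <<J>>%g [set: W] | [forall k in <<K>>%g, (k *: C)%g == C]]|.

Definition nonzero_rows (p : nat) (E : {set {set W}}) : {set {set W}} :=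
  [set J in E | [exists K in E, ~~ (p %| mark J K)%N]].

Definition decomp_entry (p : nat) (E : {set {set W}}) K L : nat :=
  [forall J in E, mark J K == mark J L %[mod p]].

(* The linear map on descent_alg with x_J |-> mark J K, as a 1 x 1 matrix. *)
Definition lambda K (z : group_alg W) : 'M[rat]_1 :=
  (\sum_(i < #|powerset S|) coord xtuple i z * (mark (enum_val i) K)%:R)%:M.

(* The map x_J |-> mark J L mod p on Z_W; the coordinates of an element of Z_W
   are integers, hence equal to their numerators. *)
Definition lambda_mod (p : nat) L (z : group_alg W) : 'M['F_p]_1 :=
  (\sum_(i < #|powerset S|)
     (numq (coord xtuple i z))%:~R * (mark (enum_val i) L)%:R)%:M.

End DescentAlgebra.

(* Reduction modulo p of a matrix-valued map; meaningful where the entries of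
   rho z are integers, numq being the identity on these. *)
Definition reduce_mod (A : Type) (p n : nat) (rho : A -> 'M[rat]_n) (z : A) :
    'M['F_p]_n :=
  map_mx (fun q : rat => (numq q)%:~R) (rho z).

(* Finite-dimensional representations over F of a quotient B / I, for B a
   subring of A and I an ideal of B, given by maps on A of which only the
   values on B matter. If B / I is an algebra over F = Q or F = F_p, additivity
   implies F-linearity. The underlying left module is 'cV[F]_n. *)
Section Representations.
Variables (A : nzRingType) (B I : A -> Prop) (F : fieldType).

Definition representation n (rho : A -> 'M[F]_n) : Prop :=
  [/\ rho 1 = 1%:M,
      forall x y, B x -> B y -> rho (x + y) = rho x + rho y,
      forall x y, B x -> B y -> rho (x * y) = rho x *m rho y
    & forall x, I x -> rho x = 0].

Definition submodule n (rho : A -> 'M[F]_n) (U : {vspace 'cV[F]_n}) : Prop :=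
  forall x u, B x -> u \in U -> rho x *m u \in U.

Definition irreducible_rep n (rho : A -> 'M[F]_n) : Prop :=
  [/\ representation rho, (0 < n)%N
    & forall U, submodule rho U -> U = 0%VS \/ U = fullv].

Definition composition_series n (rho : A -> 'M[F]_n)
    (m : nat) (U : nat -> {vspace 'cV[F]_n}) : Prop :=
  [/\ U 0%N = 0%VS, U m = fullv,
      forall i, (i <= m)%N -> submodule rho (U i),
      forall i, (i < m)%N -> (U i <= U i.+1)%VS /\ U i <> U i.+1
    & forall i V, (i < m)%N -> submodule rho V ->
        (U i <= V)%VS -> (V <= U i.+1)%VS -> V = U i \/ V = U i.+1].

(* V / U is isomorphic to the module of sigma: there is a surjective module
   homomorphism from V onto it with kernel U. *)
Definition factor_iso n (rho : A -> 'M[F]_n) (U V : {vspace 'cV[F]_n})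
    k (sigma : A -> 'M[F]_k) : Prop :=
  exists phi : 'Hom('cV[F]_n, 'cV[F]_k),
    [/\ forall x v, B x -> v \in V -> phi (rho x *m v) = sigma x *m phi v,
        (phi @: V)%VS = fullv
      & (V :&: lker phi)%VS = U].

(* The irreducible representation sigma occurs d times as a composition factor
   of the representation rho (in one, equivalently every, composition
   series). *)
Definition composition_multiplicity n (rho : A -> 'M[F]_n)
    k (sigma : A -> 'M[F]_k) (d : nat) : Prop :=
  [/\ representation rho, irreducible_rep sigma,
      exists m U, composition_series rho m U
    & forall m U, composition_series rho m U ->
        d = (\sum_(i < m) `[< factor_iso rho (U i) (U i.+1) sigma >])%N].

End Representations.

(* Main.v *)
(* Letting W act on W * bool by s : (t, e) |-> (t ^ s, e + [t = s]) yields sets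
   R w of right inversions obeying a cocycle rule, from which the deletion
   property follows: t in R w implies that w t is shorter than w. An element w
   is then minimal in w W_L exactly when R w misses W_L. For g in X_K and u in
   X_J, the intersection of W_J with W_K ^ u is the standard parabolic subgroup
   W_L with L = {s in J | u s u^-1 in W_K}, and g u lies in X_L; the number of
   such factorizations of c in X_L does not depend on c. This is Solomon's
   formula for x_K x_J, and the same count, restricted to the fixed points of
   W_M, shows that marks multiply accordingly, so lambda_M is a morphism. All
   representations in sight being one-dimensional, the decomposition number is
   1 exactly when the two representations agree modulo p on every x_J, that is
   on representatives of the conjugacy classes. *)

From HB Require Import structures.
From mathcomp Require Import all_boot all_order all_algebra all_fingroup.
From mathcomp Require Import boolp.
Require Import Defs.

Set Implicit Arguments.
Unset Strict Implicit.
Unset Printing Implicit Defensive.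

Import GRing.Theory Num.Theory.
Local Open Scope group_scope.

(** * The inversion cocycle of a Coxeter system *)

(** The signed action is defined on all pairs [(t, e)], whether or not [t] is a reflection. The
    universal property extends it from [S] to [W], and the cocycle rule is multiplicativity of the
    extension [g], read on the flag. *)
Lemma inversion_cocycle (W : finGroupType) (S : {set W}) :
  coxeter_system S ->
  exists2 R : W -> {set W},
    forall u v t, (t \in R (u * v)) = (t \in R v) (+) (t ^ v^-1 \in R u) &
    {in S, forall s, R s = [set s]}.
Proof.
case=> genS ordS univ.
have conj_eq (a b w : W) : (a ^ w == b) = (a == b ^ w^-1).
  by rewrite -(inj_eq (@conjg_inj _ w) a) conjgKV.
have sq s : s \in S -> s * s = 1.
  by move/ordS=> os; rewrite -[s * s]/(s ^+ 2) -(os : #[s] = 2%N) expg_order.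
have sV s : s \in S -> s^-1 = s by move/sq=> ss; apply/eqP; rewrite eq_invg_mul ss.
pose flip s (x : W * bool) := (x.1 ^ s, x.2 (+) (x.1 == s)).
have flip_inj s : injective (flip s).
  by move=> [t e] [t' e'] [/conjg_inj -> /addIb ->].
pose f s := perm (flip_inj s).
(* The elements [(s * t) ^+ j * s] are the reflections of the dihedral group generated by [s] and
   [t]; applying [s * t] runs through two more values of [j]. *)
have f_exp s t n r e : s \in S -> t \in S ->
    ((f s * f t) ^+ n) (r, e) =
    (r ^ ((s * t) ^+ n), e (+) \big[addb/false]_(0 <= j < n.*2) (r == (s * t) ^+ j * s)).
  move=> sS tS; elim: n => [|n IHn].
    by rewrite !expg0 perm1 big_geq // conjg1 addbF.
  have stE m : s ^ ((s * t) ^+ m)^-1 = (s * t) ^+ m.*2 * s.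
    have sts : (s * t) ^ s = (s * t)^-1 by rewrite conjgE invMg !sV // !mulgA sq // mul1g.
    have st_s : s * ((s * t) ^+ m)^-1 = (s * t) ^+ m * s.
      apply: (mulgI s^-1); rewrite mulKg -conjgE.
      by rewrite conjXg sts expgVn.
    by rewrite conjgE invgK st_s mulgA -expgD addnn.
  rewrite expgSr !permM IHn !permE /flip /= -!conjgM -expgSr.
  rewrite doubleS !big_nat_recr //= -!addbA; congr (_, _ (+) (_ (+) (_ (+) _))).
    by rewrite conj_eq stE.
  rewrite conj_eq invMg conjgM sV //.
  have -> : t ^ s = (s * t) * s by rewrite conjgE sV // mulgA.
  have stX : (s * t) ^ ((s * t) ^+ n)^-1 = s * t.
    by rewrite conjgE invgK mulgA -expgSr expgS mulgK.
  by rewrite conjMg stX stE expgS !mulgA.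
have f_rel s t : s \in S -> t \in S -> (f s * f t) ^+ #[s * t] = 1.
  move=> sS tS; apply/permP=> -[r e]; rewrite f_exp // expg_order conjg1 perm1.
  (* With [n] the order of [s * t], the indices [j] and [j + n] give the same reflection, so all
     toggles cancel in pairs. *)
  rewrite -addnn (big_cat_nat (leq0n _) (leq_addr _ _)) /=.
  rewrite -{2}[#[_]]add0n big_addn addnK.
  under [X in _ (+) (_ (+) X)]eq_bigr do rewrite expgD expg_order mulg1.
  by rewrite addbb addbF.
have [g gM gf] := univ {perm (W * bool)} f f_rel.
have g1 : g 1 = 1 by apply: (mulgI (g 1)); rewrite -gM !mulg1.
have gE w t e : g w (t, e) = (t ^ w, e (+) (g w (t, false)).2).
  have /gen_prodgP[n [c cS ->]] : w \in <<S>> by rewrite genS inE.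
  elim: n c cS t e => [|n IHn] c cS t e.
    by rewrite big_ord0 g1 !perm1 conjg1 addbF.
  rewrite big_ord_recl gM !permM (gf (c ord0)) // !permE /flip /=.
  by rewrite IHn // [in RHS]IHn //= -conjgM addbA.
(* Permutations compose from left to right, so acting by [w^-1] makes [v] come first in [u * v], as
   the cocycle rule requires. *)
exists (fun w => [set t | (g w^-1 (t, false)).2]) => [u v t | s sS].
  by rewrite !inE invMg gM permM gE gE.
by apply/setP=> t; rewrite !inE sV // gf // permE.
Qed.

(* The elements of R w are the reflections t such that w t is shorter than w. *)
Section InversionSets.
Variables (W : finGroupType) (S : {set W}) (R : W -> {set W}).
Hypothesis gen_S : <<S>> = [set: W].
Hypothesis invS : {in S, forall s, s^-1 = s}.
Hypothesis RM : forall u v t, (t \in R (u * v)) = (t \in R v) (+) (t ^ v^-1 \in R u).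
Hypothesis RS : {in S, forall s, R s = [set s]}.
Implicit Types (J K L M : {set W}) (c g s t u w x y : W).

(** * Deletion property, descents and inversions *)

Lemma inv_set1 : R 1 = set0.
Proof. by apply/setP=> t; rewrite inE -[1]mulg1 RM invg1 conjg1 addbb. Qed.

Lemma inv_setV w t : (t \in R w^-1) = (t ^ w \in R w).
Proof.
have := RM w w^-1 t; rewrite mulgV inv_set1 inE invgK.
by case: (t \in _); case: (_ \in _).
Qed.

(** Induction on the last letter [s] of the word: either [t = s], which cancels, or [t ^ s^-1] is an
    inversion of the prefix and the deletion takes place there. *)
Lemma deletion J n w t : J \subset S ->
  w \in J ^+ n -> t \in R w -> w * t \in J ^+ n.-1.
Proof.
move=> sJS; elim: n w t => [|n IHn] w t.
  by rewrite expg0 => /set1P->; rewrite inv_set1 inE.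
rewrite expgSr => /mulsgP[w' s w'J sJ ->] /=.
have sS := subsetP sJS _ sJ.
rewrite RM RS // inE -mulgA; case: eqP => [-> _ | _ /= tw'].
  by rewrite -{1}(invS sS) mulVg mulg1.
(* A prefix with an inversion is not the empty word; this excludes [n = 0], where [n.-1] would
   truncate. *)
have := IHn _ _ w'J tw'; case: n {IHn} w'J => [|n] w'J w'tJ.
  by move: tw'; move: w'J; rewrite expg0 => /set1P->; rewrite inv_set1 inE.
have -> : w' * (s * t) = w' * t ^ s^-1 * s by rewrite conjgE invgK !mulgA mulgKV.
by rewrite expgSr mem_mulg.
Qed.

Lemma cox_lengthP J w : w \in <<J>> -> w \in J ^+ cox_length J w.
Proof. by move=> wJ; rewrite /cox_length; case: ex_minnP => n /implyP->. Qed.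

Lemma cox_length_min J w n : w \in J ^+ n -> (cox_length J w <= n)%N.
Proof.
by move=> wn; rewrite /cox_length; case: ex_minnP => m _; apply; apply/implyP.
Qed.

Lemma inv_set_length J w t : J \subset S -> w \in <<J>> -> t \in R w ->
  (cox_length J (w * t) < cox_length J w)%N.
Proof.
move=> sJS wJ tw; have wn := cox_lengthP wJ.
have := cox_length_min (deletion sJS wn tw).
case: (cox_length J w) wn => [|n] //.
by rewrite expg0 => /set1P w1; move: tw; rewrite w1 inv_set1 inE.
Qed.

(** The last letter [s] of a shortest word for [u = v * s] works: otherwise [s] would be an
    inversion of [v], and deletion would make [u] shorter than [v]. *)
Lemma descent_exists J u : J \subset S -> u \in <<J>> -> u != 1 ->
  exists2 s, s \in J & s \in R u.
Proof.
move=> sJS uJ; have := cox_lengthP uJ; case def_n: (cox_length J u) => [|n].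
  by rewrite expg0 => /set1P-> /eqP.
rewrite expgSr => /mulsgP[v s vJ sJ def_u] _; exists s => //.
have sS := subsetP sJS _ sJ.
rewrite def_u RM RS // set11 /=; apply/negP; rewrite conjgE invgK mulgV mulg1 => sv.
have := cox_length_min (deletion sJS vJ sv).
by rewrite -def_u def_n leqNgt (leq_ltn_trans (leq_pred n)).
Qed.

Lemma inv_set_sub J u : J \subset S -> u \in <<J>> -> R u \subset <<J>>.
Proof.
move=> sJS /cox_lengthP; move: (cox_length J u) => n; elim: n u => [|n IHn] u.
  by rewrite expg0 => /set1P->; rewrite inv_set1 sub0set.
rewrite expgSr => /mulsgP[v s vJ sJ ->]; apply/subsetP=> t.
have sS := subsetP sJS _ sJ.
rewrite RM RS // inE; case: eqP => [-> | _ /=]; first by rewrite mem_gen.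
by move/(subsetP (IHn _ vJ)); rewrite groupJr // groupV mem_gen.
Qed.

Lemma simple_in_parabolic J s : J \subset S -> s \in S -> s \in <<J>> -> s \in J.
Proof.
move=> sJS sS sJ; have s1 : s != 1.
  by apply/eqP=> s1; have := RS sS; rewrite s1 inv_set1 => /setP/(_ 1); rewrite !inE eqxx.
by have [r rJ] := descent_exists sJS sJ s1; rewrite RS // => /set1P <-.
Qed.

(** * Minimal coset representatives and intersections of parabolic subgroups *)

(** A description of X_L that does not mention length; [mem_min_reps] proves the agreement. *)
Definition min_in L w := [disjoint R w & <<L>>].

Lemma min_inP L w : reflect (forall x, x \in <<L>> -> x \notin R w) (min_in L w).
Proof.
rewrite /min_in disjoint_sym; apply: (iffP idP) => [/disjointFr dLw x /dLw->//|dLw].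
by apply/pred0P=> x /=; apply/negP=> /andP[/dLw/negP].
Qed.

(** Uniqueness in a coset: a descent [s] of a nontrivial [u] must be cancelled in [w * u] by an
    inversion [s ^ u^-1] of [w], which lies in W_L. *)
Lemma min_in_inj L w u : L \subset S -> min_in L w -> u \in <<L>> ->
  min_in L (w * u) -> u = 1.
Proof.
move=> sLS /min_inP wL uL /min_inP wuL; apply/eqP; apply: contraT => u1.
have [s sL su] := descent_exists sLS uL u1; have sW := mem_gen sL.
have := wuL s sW; rewrite RM su /= negbK => sw.
by have := wL (s ^ u^-1); rewrite groupJr ?groupV // sw => /(_ sW).
Qed.

Lemma min_in_exists L w : L \subset S -> exists2 u, u \in <<L>> & min_in L (w * u).
Proof.
move=> sLS; have [u uL umin] := arg_minnP (fun u => cox_length S (w * u)) (group1 <<L>>).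
exists u => //; apply/min_inP => x xL; apply/negP=> xwu.
have := umin (u * x) (groupM uL xL); rewrite leqNgt mulgA inv_set_length //.
by rewrite gen_S inE.
Qed.

Lemma mem_min_reps L w : L \subset S -> (w \in min_reps S L) = min_in L w.
Proof.
move=> sLS; apply/idP/idP=> [|wL].
  rewrite inE => /forall_inP wmin; apply/min_inP => x xL; apply/negP=> xw.
  have := wmin (w * x); rewrite mem_lcoset mulKg => /(_ xL).
  by rewrite leqNgt inv_set_length // gen_S inE.
rewrite inE; apply/forall_inP=> u /lcosetP[x xL ->].
(* The shortest element [w * y] of the coset is inversion-free for W_L, so by uniqueness it is [w]
   itself. *)
have [y yL ymin] := arg_minnP (fun u => cox_length S (w * u)) (group1 <<L>>).
suff y1 : y = 1 by have := ymin x xL; rewrite y1 mulg1.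
apply: (min_in_inj sLS wL yL); apply/min_inP => z zL; apply/negP=> zwy.
have := ymin (y * z) (groupM yL zL); rewrite leqNgt mulgA inv_set_length //.
by rewrite gen_S inE.
Qed.

(* For u in X_J, it generates the stabilizer of the cosets W_J and u^-1 W_K. *)
Definition meet_type J K u := [set s in J | s ^ u^-1 \in <<K>>].

Lemma meet_type_sub J K u : meet_type J K u \subset J.
Proof. by apply/subsetP=> s /setIdP[]. Qed.

(** For the inclusion from right to left, strip a descent [s] in [J] from [x]. As [u] has no
    inversion in W_J, the cocycle rule turns [s] into the inversion [s ^ u^-1] of [x ^ u^-1]; it
    thus lies in W_K, so [s] has the required type. *)
Lemma mem_gen_meet_type J K u x : J \subset S -> K \subset S -> min_in J u ->
  (x \in <<meet_type J K u>>) = (x \in <<J>>) && (x ^ u^-1 \in <<K>>).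
Proof.
move=> sJS sKS /min_inP uJ; apply/idP/andP=> [xL | [xJ]].
  split; first exact: subsetP (genS (meet_type_sub J K u)) _ xL.
  rewrite -mem_conjg; apply: subsetP xL; rewrite gen_subG.
  by apply/subsetP=> s /setIdP[_]; rewrite mem_conjg.
have := cox_lengthP xJ; move: (cox_length J x) => n.
elim: n x xJ => [|n IHn] x xJ xn xK.
  by move: xn; rewrite expg0 => /set1P->.
have [->|x1] := eqVneq x 1; first exact: group1.
have [s sJ sx] := descent_exists sJS xJ x1; have sW := mem_gen sJ.
have sK : s ^ u^-1 \in <<K>>.
  apply: (subsetP (inv_set_sub sKS xK)).
  have -> : x ^ u^-1 = u * x * u^-1 by rewrite conjgE invgK mulgA.
  rewrite RM inv_setV invgK conjgKV (negPf (uJ s sW)) RM sx /=.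
  by apply: uJ; rewrite groupJr ?groupV.
have sL : s \in <<meet_type J K u>> by rewrite mem_gen // inE sJ.
rewrite -(groupMr _ sL); apply: IHn; first exact: groupM.
  exact: (deletion sJS xn sx).
by rewrite conjMg groupM.
Qed.

Lemma min_in_mul J K g u : J \subset S -> K \subset S ->
  min_in K g -> min_in J u -> min_in (meet_type J K u) (g * u).
Proof.
move=> sJS sKS /min_inP gK uJ; apply/min_inP => x.
rewrite mem_gen_meet_type // RM => /andP[xJ xK].
by rewrite (negPf (gK _ xK)) addbF; move/min_inP: uJ; apply.
Qed.

(** * Counting factorizations and Solomon's product formula *)

(** The element [u] encodes the factorization of [c] into [c * u^-1] in X_K and [u] in X_J. *)
Definition fiber J K L c :=
  [set u | [&& min_in J u, min_in K (c * u^-1) & meet_type J K u == L]].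

(* u and a^-1 u represent the same coset of W_K, and c' = (c' u^-1 a) (a^-1 u). *)
Lemma fiber_shift J K L c c' u a : J \subset S -> K \subset S ->
  min_in L c' -> u \in fiber J K L c -> a \in <<K>> ->
  min_in K (c' * u^-1 * a) -> a^-1 * u \in fiber J K L c'.
Proof.
move=> sJS sKS /min_inP c'L; rewrite !inE => /and3P[uJ _ /eqP uL] aK gK.
have c'E : c' = (c' * u^-1 * a) * (a^-1 * u) by rewrite mulgA mulgK mulgKV.
rewrite invMg invgK mulgA gK /= -uL; apply/andP; split; last first.
  apply/eqP/setP=> s; rewrite !inE invMg invgK conjgM.
  by rewrite groupJr.
(* Such an inversion [x] is not one of [u], so it comes from [a^-1] and [x ^ u^-1] is in W_K. Hence
   [x] is in W_L, and it would be an inversion of [c']. *)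
apply/min_inP=> x xJ; apply/negP=> xu'.
have xK : x ^ u^-1 \in <<K>>.
  move: xu'; rewrite RM (negPf (min_inP _ _ uJ x xJ)) /=.
  by apply: (subsetP (inv_set_sub sKS _)); rewrite groupV.
have xL : x \in <<L>> by rewrite -uL mem_gen_meet_type // xJ.
have := c'L x xL; rewrite c'E RM xu' /= negbK.
by apply/negP/(min_inP _ _ gK); rewrite invMg invgK conjgM groupJr.
Qed.

Lemma leq_card_fiber J K L c c' : J \subset S -> K \subset S ->
  min_in L c' -> (#|fiber J K L c| <= #|fiber J K L c'|)%N.
Proof.
move=> sJS sKS c'L.
(* The default [1] is never taken, since every coset of W_K has a minimal element. *)
pose a u := odflt 1 [pick a in <<K>> | min_in K (c' * u^-1 * a)].
have aP u : a u \in <<K>> /\ min_in K (c' * u^-1 * a u).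
  rewrite /a; case: pickP => [x /andP[] // | no].
  have [x xK xmin] := min_in_exists (c' * u^-1) sKS.
  by have := no x; rewrite xK xmin.
(* Equal images put [u] and [v] in one right coset of W_K; then [c * u^-1] and [c * v^-1] are
   minimal in one left coset, hence equal. *)
have f_inj : {in fiber J K L c &, injective (fun u => (a u)^-1 * u)}.
  move=> u v /[!inE] /and3P[_ uK _] /and3P[_ vK _] E.
  have uv : u * v^-1 \in <<K>>.
    have -> : u * v^-1 = a u * (a v)^-1.
      by apply: (mulIg v); rewrite mulgKV -mulgA -E mulKVg.
    by rewrite groupM ?groupV; case: (aP u); case: (aP v).
  have := min_in_inj sKS uK uv; rewrite mulgA mulgKV => /(_ vK) /eqP.
  by rewrite -eq_mulgV1 => /eqP.
rewrite -(card_in_imset f_inj); apply/subset_leq_card/subsetP => _ /imsetP[u uF ->].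
by have [aK aM] := aP u; apply: fiber_shift uF aK aM.
Qed.

Lemma min_in1 L : min_in L 1.
Proof. by apply/min_inP=> x _; rewrite inv_set1 inE. Qed.

Lemma card_fiber J K L c : J \subset S -> K \subset S ->
  min_in L c -> #|fiber J K L c| = #|fiber J K L 1|.
Proof.
by move=> sJS sKS cL; apply/eqP; rewrite eqn_leq !leq_card_fiber // min_in1.
Qed.

(** The coefficient at [c] counts the factorizations of [c], sorted by type [L]. Since the count is
    constant on X_L, it may be taken at [1]. *)
Lemma xbasis_mul J K : J \subset S -> K \subset S ->
  (xbasis S K * xbasis S J =
   \sum_(L in powerset S) xbasis S L *+ #|fiber J K L 1%g|)%R.
Proof.
move=> sJS sKS; apply/ffunP=> c; rewrite sum_ffunE ffunE.
transitivity (#|[set u | min_in J u && min_in K (c * u^-1)]|%:R : rat)%R.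
  rewrite (reindex_inj (inj_comp (mulgI c) invg_inj)) /= -sum1_card natr_sum.
  rewrite [RHS]big_mkcond /=; apply: eq_bigr => u _.
  rewrite !ffunE !mem_min_reps // inE invMg invgK mulgKV.
  by case: (min_in J u); case: (min_in K _); rewrite ?mulr0 ?mul0r ?mulr1.
rewrite -sum1_card (partition_big (meet_type J K) (mem (powerset S))) /=; last first.
  by move=> u _; rewrite powersetE (subset_trans (meet_type_sub J K u)).
rewrite natr_sum; apply: eq_bigr => L; rewrite powersetE => sLS.
rewrite ffunMnE ffunE mem_min_reps //.
transitivity (#|fiber J K L c|%:R : rat)%R.
  by rewrite -sum1_card; congr (_%:R)%R; apply: eq_bigl => u; rewrite !inE andbA.
case cL : (min_in L c); first by rewrite card_fiber.
(* Outside X_L there is no factorization of type [L], because such a product is always minimal. *)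
rewrite mul0rn (_ : fiber J K L c = set0) ?cards0 //.
apply/setP=> u; rewrite !inE; apply/and3P=> -[uJ gK /eqP uL].
by have := min_in_mul sJS sKS gK uJ; rewrite uL mulgKV cL.
Qed.

(** * Marks and their multiplicativity *)

(** Fixed points of [H] on W/W_L, seen on minimal representatives: [H] fixes c W_L exactly when
    [H :^ c] lies in W_L. *)
Definition fixers L H := [set c | min_in L c && (H :^ c \subset <<L>>)].

(** Counting elements instead of representatives gives sets that translations of [W] permute, which
    yields the conjugation invariances below. *)
Lemma card_fixers L H : L \subset S ->
  #|[set w | H :^ w \subset <<L>>]| = (#|fixers L H| * #|<<L>>|)%N.
Proof.
move=> sLS; rewrite -cardsX.
have f_inj : {in setX (fixers L H) <<L>> &, injective (fun x : W * W => x.1 * x.2)}.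
  move=> [c u] [d v] /setXP[/= + uL] /setXP[/= + vL] /= E.
  rewrite !inE => /andP[cL _] /andP[dL _].
  have dE : d = c * (u * v^-1) by rewrite mulgA E mulgK.
  have uv : u * v^-1 = 1.
    by apply: (min_in_inj sLS cL); rewrite -?dE // groupM ?groupV.
  by rewrite dE uv mulg1; move/eqP: uv; rewrite -eq_mulgV1 => /eqP->.
rewrite -(card_in_imset f_inj); apply: eq_card => w; rewrite inE.
apply/idP/imsetP=> [wH | [[c u] /setXP[/= /setIdP[cL cH] uL] ->]].
  have [u uL wuL] := min_in_exists w sLS.
  exists (w * u, u^-1); last by rewrite /= mulgK.
  by rewrite !inE /= wuL groupV uL andbT /= conjsgM conj_subG.
by rewrite conjsgM conj_subG.
Qed.

Lemma card_fixersJ L H g : L \subset S -> #|fixers L (H :^ g)| = #|fixers L H|.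
Proof.
move=> sLS; apply/eqP; rewrite -(eqn_pmul2r (cardG_gt0 <<L>>)) -!card_fixers //.
apply/eqP; rewrite -(card_imset _ (mulgI g)); apply: eq_card => w.
rewrite -[w in LHS](mulKVg g) mem_imset; last exact: mulgI.
by rewrite !inE -conjsgM mulKVg.
Qed.

Lemma mark_fixers L M : L \subset S -> mark L M = #|fixers L <<M>>|.
Proof.
move=> sLS; have f_inj : {in fixers L <<M>> &, injective (fun c => c *: <<L>>)}.
  move=> c d /setIdP[cL _] /setIdP[dL _] /lcoset_eqP; rewrite mem_lcoset => dc.
  have := min_in_inj sLS dL dc; rewrite mulKVg => /(_ cL)/eqP.
  by rewrite -eq_mulVg1 => /eqP.
have fixE c : [forall k in <<M>>, k *: (c *: <<L>>) == c *: <<L>>] = (<<M>> :^ c \subset <<L>>).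
  apply/forall_inP/subsetP=> [fixM _ /imsetP[k kM ->] | MC k kM].
    have /eqP := fixM k kM; rewrite -lcosetM => /lcoset_eqP.
    by rewrite mem_lcoset conjgE.
  rewrite -lcosetM; apply/eqP/lcoset_eqP; rewrite mem_lcoset -conjgE.
  by apply: MC; rewrite memJ_conjg.
rewrite /mark -(card_in_imset f_inj); apply: eq_card => C; rewrite inE.
apply/andP/imsetP=> [[/lcosetsP[w _ ->]] | [c /setIdP[_ cM] ->]].
  have [u uL wuL] := min_in_exists w sLS; rewrite fixE => wM.
  exists (w * u); last by apply/lcoset_eqP; rewrite mem_lcoset invMg mulgKV groupV.
  by rewrite inE wuL conjsgM conj_subG.
by rewrite fixE; split=> //; apply/lcosetsP; exists c.
Qed.

(** Both sides count pairs [(g, u)] with [g] a fixer for [K] and [M], and [u] one for [J] and the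
    conjugate of [M] by [g]; the left side groups them by the type of [u], with [c = g * u]. *)
Lemma mark_mul J K M : J \subset S -> K \subset S ->
  (\sum_(L in powerset S) #|fiber J K L 1| * mark L M = mark K M * mark J M)%N.
Proof.
move=> sJS sKS; rewrite !mark_fixers //.
pose Q (x : W * W) :=
  [&& min_in J x.2, min_in K (x.1 * x.2^-1) & x.1 \in fixers (meet_type J K x.2) <<M>>].
transitivity (\sum_(x : W * W | Q x) 1)%N.
  rewrite [RHS](partition_big (fun x : W * W => meet_type J K x.2) (mem (powerset S))) /=; last first.
    by move=> u _; rewrite powersetE (subset_trans (meet_type_sub _ _ _)).
  apply: eq_bigr => L; rewrite powersetE => sLS; rewrite mark_fixers // mulnC.
  rewrite -sum_nat_const.
  under eq_bigr => c /setIdP[cL _] do rewrite -(card_fiber sJS sKS cL) -sum1_card.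
  rewrite pair_big_dep /=; apply: eq_bigl => -[c u] /=.
  rewrite /Q /= [u \in _]inE; case: eqP => [->|_]; last by rewrite !andbF.
  by rewrite !andbT andbC andbA.
transitivity (\sum_(g in fixers K <<M>>) \sum_(u in fixers J (<<M>> :^ g)) 1)%N; last first.
  under eq_bigr do rewrite sum1_card card_fixersJ //.
  by rewrite sum_nat_const.
rewrite pair_big_dep /= (reindex_inj (h := fun x : W * W => (x.1 * x.2, x.2))); last first.
  by move=> [a b] [c d] [/= + E]; rewrite E => /mulIg->.
apply: eq_bigl => -[g u]; rewrite /Q !inE /= mulgK.
case uJ : (min_in J u); rewrite ?andbF //=; case gK : (min_in K g) => //=.
rewrite min_in_mul //=.
(* Being conjugated into this intersection by [g * u] splits into one condition for [J] and, after
   cancelling [u], one for [K]. *)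
have -> : <<meet_type J K u>> = <<J>> :&: <<K>> :^ u.
  by apply/setP=> x; rewrite mem_gen_meet_type // inE mem_conjg.
by rewrite subsetI !conjsgM conjSg andbC.
Qed.

Lemma mark_conj J K x : J \subset S -> J :^ x \subset S ->
  mark (J :^ x) K = mark J K.
Proof.
move=> sJS sJxS; rewrite !mark_fixers //; apply/eqP.
rewrite -(eqn_pmul2r (cardG_gt0 <<J>>)) -card_fixers // -(cardJg <<J>> x) -genJ.
rewrite -card_fixers // -(card_imset _ (mulIg x^-1)); apply/eqP/eq_card => w.
rewrite -[w in LHS](mulgK x) (mem_imset _ _ (mulIg x^-1)).
by rewrite !inE genJ conjsgM conjSg.
Qed.

(** * Unit and linear independence of the [xbasis] family *)

Lemma xbasis_full : (xbasis S S = 1)%R.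
Proof.
apply/ffunP=> w; rewrite !ffunE mem_min_reps //; congr (nat_of_bool _)%:R%R.
apply/idP/eqP=> [wS | ->]; last exact: min_in1.
have wV : w^-1 \in <<S>> by rewrite gen_S inE.
have := min_in_inj (subxx S) wS wV; rewrite mulgV => /(_ (min_in1 S)) w1.
by rewrite -[w]invgK w1 invg1.
Qed.

(* The witness is the longest element of the subgroup generated by S :\: L. *)
Lemma descent_witness L : L \subset S ->
  exists w, forall M, M \subset S -> min_in M w = (M \subset L).
Proof.
move=> sLS; have sIS : S :\: L \subset S by apply: subsetDl.
have [w wI wmax] := arg_maxnP (cox_length S) (group1 <<S :\: L>>).
exists w => M sMS; apply/idP/idP=> [/min_inP wM | sML].
  apply/subsetP=> s sM; have sS := subsetP sMS _ sM; apply: contraT => sL.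
  have sI : s \in <<S :\: L>> by rewrite mem_gen // inE sL.
  have : (cox_length S (w * s) <= cox_length S w)%N := wmax _ (groupM wI sI).
  rewrite leqNgt.
  have swsR : s \in R (w * s).
    by rewrite RM RS // set11 conjgE invgK mulgV mulg1 (negPf (wM _ (mem_gen sM))).
  have := inv_set_length (subxx S) _ swsR; rewrite gen_S inE => /(_ isT).
  by rewrite -mulgA -{2}(invS sS) mulgV mulg1 => ->.
(* If [w] were not minimal, a descent of [u^-1] in [M] would be an inversion of [w], hence a member
   of [S :\: L], against [M \subset L]. *)
have [u uM wuM] := min_in_exists w sMS.
have [u1|u1] := eqVneq u^-1 1; first by move: wuM; rewrite -[u]invgK u1 invg1 mulg1.
have uVM : u^-1 \in <<M>> by rewrite groupV.
have [s sM su] := descent_exists sMS uVM u1.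
have sw : s \in R w.
  rewrite -[w](mulgK u) RM su invgK /=; apply: (min_inP _ _ wuM).
  by rewrite groupJr // mem_gen.
have := simple_in_parabolic sIS (subsetP sMS _ sM) (subsetP (inv_set_sub sIS wI) _ sw).
by rewrite inE (subsetP sML).
Qed.

Lemma xtuple_nth (i : 'I_#|powerset S|) :
  ((xtuple S)`_i)%R = xbasis S (enum_val i).
Proof. by rewrite -tnth_nth tnth_map; rewrite (tnth_nth (enum_val i)) -enum_val_nth. Qed.

Lemma enum_powerset_sub (i : 'I_#|powerset S|) : enum_val i \subset S.
Proof. by have := enum_valP i; rewrite powersetE. Qed.

(** Triangularity for inclusion: at the witness for [L] only the basis elements of subsets of [L]
    are nonzero, and proper subsets are handled by induction on cardinality. *)
Lemma xtuple_free : free (xtuple S).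
Proof.
apply/freeP => k k0.
suff IH n (i : 'I_#|powerset S|) : (#|pred_of_set (enum_val i)| < n)%N -> k i = 0%R.
  by move=> i; apply: (IH _ i (ltnSn _)).
elim: n i => // n IHn i; rewrite ltnS => leLn.
have [w wE] := descent_witness (enum_powerset_sub i).
move/ffunP/(_ w): k0; rewrite sum_ffunE ffunE (bigD1 i) //= big1 => [|j ji].
  rewrite addr0 xtuple_nth !ffunE mem_min_reps ?enum_powerset_sub //.
  by rewrite wE ?enum_powerset_sub // subxx => <-; rewrite [RHS]mulr1.
rewrite xtuple_nth !ffunE mem_min_reps ?enum_powerset_sub //.
rewrite wE ?enum_powerset_sub //; case sji: (_ \subset _); last exact: mulr0.
rewrite IHn ?scale0r //; apply: leq_trans leLn; apply: proper_card.
by rewrite properEneq sji andbT (inj_eq enum_val_inj).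
Qed.

Local Open Scope ring_scope.

(** * The rational characters of the descent algebra *)

Definition char_val K (z : group_alg W) : rat :=
  \sum_(i < #|powerset S|) coord (xtuple S) i z * (mark (enum_val i) K)%:R.

Lemma char_val_is_linear K : linear_for *%R (char_val K).
Proof.
move=> a x y; rewrite /char_val mulr_sumr -big_split /=; apply: eq_bigr => i _.
by rewrite linearP /= mulrDl mulrA.
Qed.
HB.instance Definition _ K :=
  GRing.isLinear.Build rat (group_alg W) rat *%R (char_val K) (char_val_is_linear K).

Lemma coord_xbasis i L : L \subset S ->
  coord (xtuple S) i (xbasis S L) = (enum_val i == L)%:R.
Proof.
rewrite -powersetE => LS; pose j := enum_rank_in LS L.
have <- : enum_val j = L by rewrite enum_rankK_in.
by rewrite -xtuple_nth coord_free ?xtuple_free // (inj_eq enum_val_inj) eq_sym.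
Qed.

Lemma char_val_xbasis K L : L \subset S -> char_val K (xbasis S L) = (mark L K)%:R.
Proof.
move=> sLS; have LS : L \in powerset S by rewrite powersetE.
rewrite /char_val; under eq_bigr do rewrite coord_xbasis //.
rewrite (bigD1 (enum_rank_in LS L)) //= enum_rankK_in // eqxx mul1r.
rewrite big1 ?addr0 // => i iL; rewrite (_ : enum_val i == L = false) ?mul0r //.
by apply/negP=> /eqP E; move: iL; rewrite -{2}E enum_valK_in eqxx.
Qed.

Lemma char_val_xbasis_mul M J K : J \subset S -> K \subset S ->
  char_val M (xbasis S K * xbasis S J) = (mark K M)%:R * (mark J M)%:R.
Proof.
move=> sJS sKS; rewrite xbasis_mul // linear_sum -natrM -mark_mul //= natr_sum.
apply: eq_bigr => L; rewrite powersetE => sLS.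
by rewrite linearMn /= char_val_xbasis // natrM mulr_natl.
Qed.

Lemma char_val1 K : char_val K 1 = 1.
Proof.
rewrite -xbasis_full char_val_xbasis // mark_fixers // (_ : #|_| = 1%N) //.
apply/eqP; rewrite -(eqn_pmul2r (cardG_gt0 <<S>>)) -card_fixers // mul1n.
by apply/eqP/eq_card => w; rewrite [RHS](_ : _ = (w \in <<S>>)%g) // gen_S !inE subsetT.
Qed.

Lemma galg_mulE (x y : group_alg W) w : (x * y) w = \sum_u (x u : rat) * y (u^-1 * w)%g.
Proof. by rewrite ffunE. Qed.

Lemma galg_scaleAl (a : rat) (x y : group_alg W) : (a *: x) * y = a *: (x * y).
Proof.
apply/ffunP=> w; rewrite [RHS]ffunE !galg_mulE [RHS]mulr_sumr.
by apply: eq_bigr => u _; rewrite ffunE mulrA.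
Qed.

Lemma galg_scaleAr (a : rat) (x y : group_alg W) : x * (a *: y) = a *: (x * y).
Proof.
apply/ffunP=> w; rewrite [RHS]ffunE !galg_mulE [RHS]mulr_sumr.
by apply: eq_bigr => u _; rewrite ffunE mulrCA.
Qed.

Lemma descent_mulE (x y : group_alg W) : x \in descent_alg S -> y \in descent_alg S ->
  x * y = \sum_i \sum_j (coord (xtuple S) i x * coord (xtuple S) j y) *:
            (xbasis S (enum_val i) * xbasis S (enum_val j)).
Proof.
move=> /coord_span xE /coord_span yE; rewrite {1}xE {1}yE mulr_suml.
apply: eq_bigr => i _; rewrite mulr_sumr; apply: eq_bigr => j _.
by rewrite galg_scaleAl galg_scaleAr scalerA !xtuple_nth.
Qed.

(** On basis elements this is Solomon's formula combined with [mark_mul]; bilinearity does the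
    rest. *)
Lemma char_valM K (x y : group_alg W) : x \in descent_alg S -> y \in descent_alg S ->
  char_val K (x * y) = char_val K x * char_val K y.
Proof.
move=> xS yS; rewrite descent_mulE // linear_sum [in RHS]/char_val mulr_suml /=.
apply: eq_bigr => i _; rewrite linear_sum mulr_sumr /=; apply: eq_bigr => j _.
by rewrite linearZ /= char_val_xbasis_mul ?enum_powerset_sub // mulrACA.
Qed.

Lemma lambdaE K z : lambda S K z = (char_val K z)%:M.
Proof. by []. Qed.

Lemma lambda_rep K : representation (in_descent_alg S) (fun z => z = 0) (lambda S K).
Proof.
split=> [|x y _ _|x y xS yS|x ->]; rewrite !lambdaE.
- by rewrite char_val1.
- by rewrite linearD /= raddfD.
- by rewrite char_valM // scalar_mxM.
- by rewrite linear0 raddf0.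
Qed.

(** * Integrality and reduction modulo p *)

Lemma in_ZW_xbasis L : L \subset S -> in_ZW S (xbasis S L).
Proof.
move=> sLS; exists (fun M => (M == L)%:Z); rewrite (bigD1 L) ?powersetE //= eqxx.
by rewrite big1 ?addr0 // => M /andP[_ /negPf->].
Qed.

Lemma in_ZW_span z : in_ZW S z -> z \in descent_alg S.
Proof.
case=> c ->; rewrite big_enum_val /=; apply: rpred_sum => i _; apply: rpredMz.
by rewrite -xtuple_nth memv_span ?mem_nth ?size_tuple.
Qed.

Lemma in_ZW_coord z : in_ZW S z -> forall i, coord (xtuple S) i z \is a Num.int.
Proof.
case=> c -> i; rewrite linear_sum /=; apply: rpred_sum => L.
rewrite powersetE => sLS; rewrite raddfMz /= coord_xbasis //.
by rewrite rpredMz // rpred_nat.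
Qed.

Lemma in_ZW_mul_coord (x y : group_alg W) i : in_ZW S x -> in_ZW S y ->
  coord (xtuple S) i (x * y) \is a Num.int.
Proof.
move=> xZ yZ; rewrite descent_mulE ?in_ZW_span // linear_sum /=; apply: rpred_sum => j _.
rewrite linear_sum /=; apply: rpred_sum => k _; rewrite linearZ /=.
apply: rpredM; first by rewrite rpredM ?in_ZW_coord.
rewrite xbasis_mul ?enum_powerset_sub //.
rewrite linear_sum /=; apply: rpred_sum => L.
by rewrite powersetE => sLS; rewrite raddfMn /= coord_xbasis // rpredMn ?rpred_nat.
Qed.

Lemma char_val_int K z : (forall i, coord (xtuple S) i z \is a Num.int) ->
  char_val K z \is a Num.int.
Proof. by move=> zZ; apply: rpred_sum => i _; rewrite rpredM ?rpred_nat. Qed.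

Section ModP.
Variable p : nat.

(* Reduction modulo p of rational integers; junk on other rationals. *)
Definition numF (q : rat) : 'F_p := (numq q)%:~R.

Lemma numFD q r : q \is a Num.int -> r \is a Num.int -> numF (q + r) = numF q + numF r.
Proof. by move=> /intrP[m ->] /intrP[n ->]; rewrite /numF -intrD !numq_int intrD. Qed.

Lemma numFM q r : q \is a Num.int -> r \is a Num.int -> numF (q * r) = numF q * numF r.
Proof. by move=> /intrP[m ->] /intrP[n ->]; rewrite /numF -intrM !numq_int intrM. Qed.

Lemma numF_nat n : numF n%:R = n%:R.
Proof. by rewrite /numF pmulrn numq_int pmulrn. Qed.

Lemma numF_sum n (F : 'I_n -> rat) : (forall i, F i \is a Num.int) ->
  numF (\sum_i F i) = \sum_i numF (F i).
Proof.
move=> F_int.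
suff [] : numF (\sum_i F i) = \sum_i numF (F i) /\ \sum_i F i \is a Num.int by [].
apply: (big_rec2 (fun (x : 'F_p) (y : rat) => numF y = x /\ y \is a Num.int)) => [|i x y _ [<- y_int]].
  by rewrite (numF_nat 0) rpred0.
by rewrite numFD ?rpredD.
Qed.

Lemma reduce_lambdaE K z : reduce_mod p (lambda S K) z = (numF (char_val K z))%:M.
Proof.
by apply/matrixP=> i j; rewrite !mxE !ord1 eqxx.
Qed.

(** Numerators commute with sums and products of integers, so reducing coordinates first or the
    final value gives the same result. Hence [lambda_mod] inherits its properties from the reduction
    of [lambda]. *)
Lemma lambda_modE K z : (forall i, coord (xtuple S) i z \is a Num.int) ->
  lambda_mod S p K z = reduce_mod p (lambda S K) z.
Proof.
move=> zZ; rewrite reduce_lambdaE /char_val numF_sum => [|i]; last by rewrite rpredM ?rpred_nat.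
congr (_%:M); apply: eq_bigr => i _.
by rewrite numFM ?rpred_nat ?numF_nat.
Qed.

Lemma reduce_lambda_rep K : prime p ->
  representation (in_ZW S) (in_pZW S p) (reduce_mod p (lambda S K)).
Proof.
move=> p_pr; have int_val z : in_ZW S z -> char_val K z \is a Num.int.
  by move=> zZ; apply: char_val_int => i; apply: in_ZW_coord.
split=> [|x y xZ yZ|x y xZ yZ|x [y yZ ->]]; rewrite !reduce_lambdaE.
- by rewrite char_val1 (numF_nat 1).
- by rewrite linearD numFD ?int_val // raddfD.
- by rewrite char_valM ?in_ZW_span // numFM ?int_val // scalar_mxM.
- rewrite linearMn /= -mulr_natr numFM ?int_val ?rpred_nat // numF_nat.
  by rewrite pchar_Fp_0 // mulr0 raddf0.
Qed.

Lemma lambda_mod_rep L : prime p ->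
  representation (in_ZW S) (in_pZW S p) (lambda_mod S p L).
Proof.
move=> p_pr; have [r1 rD rM rI] := reduce_lambda_rep L p_pr.
have ZE := lambda_modE L; split=> [|x y xZ yZ|x y xZ yZ|x xI].
- by rewrite ZE // -xbasis_full; apply/in_ZW_coord/in_ZW_xbasis.
- by rewrite !ZE ?rD // => i; rewrite ?linearD ?rpredD ?in_ZW_coord.
- by rewrite !ZE ?rM // => i; rewrite ?in_ZW_mul_coord ?in_ZW_coord.
- rewrite ZE ?rI // => i; case: xI => y yZ ->.
  by rewrite linearMn rpredMn ?in_ZW_coord.
Qed.

(** Evaluate at the basis elements in one direction, expand in integral coordinates in the other. *)
Lemma eq_reduce_lambda_mod K L : prime p ->
  (forall z, in_ZW S z -> reduce_mod p (lambda S K) z = lambda_mod S p L z) <->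
  (forall J, J \subset S -> mark J K = mark J L %[mod p]).
Proof.
move=> p_pr.
have natFE m n : (m%:R = n%:R :> 'F_p) <-> m = n %[mod p].
  split=> [/(congr1 val)|E]; first by rewrite /= !val_Fp_nat.
  by apply: val_inj; rewrite /= !val_Fp_nat.
have scalar_inj (a b : 'F_p) : a%:M = b%:M :> 'M_1 -> a = b.
  by move/matrixP/(_ 0 0); rewrite !mxE.
split=> [E J sJS | E z zZ].
  have JZ := in_ZW_xbasis sJS.
  have := E _ JZ; rewrite lambda_modE ?reduce_lambdaE; last exact: in_ZW_coord.
  by rewrite !char_val_xbasis // !numF_nat => /scalar_inj/natFE.
have zi := in_ZW_coord zZ; rewrite lambda_modE // !reduce_lambdaE; congr (_%:M).
rewrite /char_val !numF_sum => [|i|i]; try by rewrite rpredM ?rpred_nat.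
apply: eq_bigr => i _; rewrite !numFM ?rpred_nat // !numF_nat; congr (_ * _).
by apply/natFE/E/enum_powerset_sub.
Qed.

End ModP.

End InversionSets.

(** * Composition factors of one-dimensional representations *)

Section OneDimensional.
Local Open Scope ring_scope.
Variables (A : nzRingType) (B I : A -> Prop) (F : fieldType).
Implicit Types (rho sigma : A -> 'M[F]_1) (U : {vspace 'cV[F]_1}).

Lemma vspace_cV1 U : U = 0%VS \/ U = fullv.
Proof.
have dim1 : \dim {: 'cV[F]_1} = 1%N by rewrite dimvf dim_matrix.
have := dimvS (subvf U); rewrite dim1 leq_eqVlt ltnS leqn0 dimv_eq0.
case/orP=> /eqP; last by left.
by move=> U1; right; apply/eqP; rewrite eqEdim subvf dim1 U1.
Qed.

Lemma vspace_cV1_neq : 0%VS <> fullv :> {vspace 'cV[F]_1}.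
Proof. by move/(congr1 (fun U => \dim U)); rewrite dimv0 dimvf dim_matrix. Qed.

Lemma submodule_cV1 rho U : submodule B rho U.
Proof.
move=> x u _; case: (vspace_cV1 U) => ->; last by rewrite !memvf.
by rewrite !memv0 => /eqP->; rewrite mulmx0.
Qed.

Lemma irreducible_rep1 rho : representation B I rho -> irreducible_rep B I rho.
Proof. by move=> rho_rep; split=> // U _; apply: vspace_cV1. Qed.

(** An isomorphism of lines intertwines scalars only if they are equal; conversely the identity map
    serves. *)
Lemma factor_iso1 rho sigma :
  factor_iso B rho 0%VS fullv sigma <-> (forall x, B x -> rho x = sigma x).
Proof.
have scalar1 (M : 'M[F]_1) (v : 'cV[F]_1) : M *m v = M 0 0 *: v.
  by rewrite [M]mx11_scalar mul_scalar_mx mxE eqxx.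
split=> [[phi [phiE _ ker0]] x Bx | E].
  pose v : 'cV[F]_1 := const_mx 1.
  have v0 : phi v != 0.
    rewrite -memv_ker; apply/negP=> vk.
    have : v \in 0%VS by rewrite -ker0 capfv.
    by rewrite memv0 => /eqP/matrixP/(_ 0 0)/eqP; rewrite !mxE oner_eq0.
  have := phiE x v Bx (memvf v); rewrite !scalar1 linearZ /= => /eqP.
  rewrite -subr_eq0 -scalerBl scaler_eq0 (negPf v0) orbF subr_eq0 => /eqP E.
  by rewrite [rho x]mx11_scalar [sigma x]mx11_scalar E.
exists \1%VF; split=> [x v Bx _||]; first by rewrite !id_lfunE E.
  by rewrite lim1g.
by apply/eqP; rewrite -subv0 capfv; apply/subvP=> v; rewrite memv_ker id_lfunE memv0.
Qed.

(** Strict inclusions in a line allow exactly one step: length 0 would identify 0 with the line, and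
    a second step would have to leave it. *)
Lemma composition_series1 rho m (U : nat -> {vspace 'cV[F]_1}) :
  composition_series B rho m U <->
  [/\ m = 1%N, U 0%N = 0%VS & U 1%N = fullv].
Proof.
split=> [[U0 Um _ U_inc _]|[-> U0 U1]]; last first.
  split=> // [i _|[|i] //|[|i] V // _ _ _ _]; first exact: submodule_cV1.
    by rewrite U0 U1 sub0v; split=> //; apply: vspace_cV1_neq.
  by rewrite U0 U1; apply: vspace_cV1.
case: m Um U_inc => [|[|m]] Um U_inc //; first by case: vspace_cV1_neq; rewrite -U0 -Um.
have [_ U01] := U_inc 0%N isT; have [U12 nU12] := U_inc 1%N isT.
case: (vspace_cV1 (U 1%N)) => U1; first by case: U01; rewrite U0 U1.
case: nU12; rewrite U1 in U12 *.
by apply/eqP; rewrite eqEsubv U12 subvf.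
Qed.

Lemma composition_multiplicity1 rho sigma (d : nat) :
  representation B I rho -> representation B I sigma ->
  d = `[< forall x, B x -> rho x = sigma x >] ->
  composition_multiplicity B I rho sigma d.
Proof.
move=> rho_rep sigma_rep ->; split=> //; first exact: irreducible_rep1.
  exists 1%N, (fun i => if i is 0%N then 0%VS else fullv).
  by apply/composition_series1.
move=> m U /composition_series1[-> U0 U1].
rewrite big_ord1 /= U0 U1; congr (nat_of_bool _).
by apply/asbool_equiv_eq; rewrite factor_iso1.
Qed.

End OneDimensional.

(** * Class representatives and the decomposition matrix *)

Lemma class_reps_conj (W : finGroupType) (S : {set W}) (E : {set {set W}}) (J : {set W}) :
  class_reps S E -> J \subset S ->
  exists2 x, J :^ x \in E & J :^ x \subset S.
Proof.
case/and3P=> _ /subsetP sES /forall_inP EP sJS.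
have JP : [set K in powerset S | K \in J :^: [set: W]]
    \in equivalence_partition (fun J K => K \in J :^: [set: W]) (powerset S).
  by apply/imsetP; exists J; rewrite ?powersetE.
have /cards1P[K EK] := EP _ JP.
have /setIP[KE] : K \in E :&: [set K in powerset S | K \in J :^: [set: W]].
  by rewrite EK set11.
rewrite inE => /andP[KS /imsetP[x _ KJ]]; exists x; rewrite -KJ //.
by rewrite -powersetE.
Qed.

Theorem proposition2 (W : finGroupType) (S : {set W}) (p : nat)
    (E : {set {set W}}) :
  coxeter_system S -> prime p -> class_reps S E ->
  forall K L : {set W}, K \in E -> L \in nonzero_rows p E ->
  irreducible_rep (in_descent_alg S) (fun z => z = 0%R) (lambda S K)
  /\ composition_multiplicity (in_ZW S) (in_pZW S p)
       (reduce_mod p (lambda S K)) (lambda_mod S p L)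
       (decomp_entry p E K L).
Proof.
move=> coxS p_pr repE K L KE LE; have [R RM RS] := inversion_cocycle coxS.
have [gen_S ordS _] := coxS.
have invS : {in S, forall s, s^-1 = s}.
  move=> s sS; apply/eqP; rewrite eq_invg_mul -[s * s]/(s ^+ 2).
  by rewrite -(ordS s sS : #[s] = 2%N) expg_order.
split; first exact/irreducible_rep1/(lambda_rep gen_S invS RM RS).
apply: composition_multiplicity1.
- exact: (reduce_lambda_rep gen_S invS RM RS).
- exact: (lambda_mod_rep gen_S invS RM RS).
congr nat_of_bool; apply/idP/asboolP => [/forall_inP marksE | marksE].
  (* [decomp_entry] tests only [J] in [E]; invariance of marks under conjugation of [J] extends the
     congruence to every subset of [S]. *)
  apply/(eq_reduce_lambda_mod gen_S invS RM RS K L p_pr) => J sJS.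
  have [x xE xS] := class_reps_conj repE sJS.
  by have /eqP := marksE _ xE; rewrite !(mark_conj gen_S invS RM RS _ sJS xS).
apply/forall_inP => J JE; apply/eqP.
apply: (iffLR (eq_reduce_lambda_mod gen_S invS RM RS K L p_pr)) => //.
by case/and3P: repE => _ /subsetP/(_ J JE); rewrite powersetE.
Qed.
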